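(* Let $0<\lambda<\frac29$ be a fixed real number. Then there exist a constant $c>0$ and an integer $n_0$ such that for all integers $n\ge n_0$, with $m=\lfloor\lambda n\rfloor$, \[ T(n,m)\ge c\left(\frac92\lambda\right)^{\frac12\lambda n}\left(\frac97(1-\lambda)\right)^{\frac12(1-\lambda)n}. \]
   Context: Three words $x,y,z\in\{0,1,2\}^n$ triffer at position $i$ if $\{x_i,y_i,z_i\}=\{0,1,2\}$. For integers $n\ge m\ge 1$, a code $C\subseteq\{0,1,2\}^n$ is $m$-trifferent if any three distinct codewords of $C$ triffer in at least $m$ positions. $T(n,m)$ denotes the largest size of an $m$-trifferent code $C\subseteq\{0,1,2\}^n$. *)

(* Defs.v *)
From HB Require Import structures.
From mathcomp Require Import all_boot all_order all_algebra.
From mathcomp Require Import reals exp.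

Set Implicit Arguments.
Unset Strict Implicit.
Unset Printing Implicit Defensive.

Definition word (n : nat) := {ffun 'I_n -> 'I_3}.

Definition triffer (n : nat) (x y z : word n) (i : 'I_n) : bool :=
  [set x i; y i; z i] == [set: 'I_3].

Definition m_trifferent (n m : nat) (C : {set word n}) : bool :=
  [forall x in C, forall y in C, forall z in C,
     [&& x != y, y != z & x != z] ==> (m <= #|[set i | triffer x y z i]|)].

(* The empty code is m-trifferent, so the maximum is over a nonempty family. *)
Definition T (n m : nat) : nat :=
  \max_(C : {set word n} | m_trifferent m C) #|C|.

(* Main.v *)
(** Random coding with expurgation.  Call a triple of words bad if it triffers
in fewer than m positions.  For 0 < theta <= 1 the number of bad triples is at
most theta^-m (21 + 6 theta)^n, since 6 of the 27 letter triples triffer;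
theta = 7 lambda / (2 (1 - lambda)) gives a proportion at most A^-2 of bad
triples, where A is the claimed lower bound.  Hence some family of about A/2
words contains at most A/8 bad triples of indices, and deleting one index from
each of them leaves an m-trifferent code. *)

Require Import Defs.
From HB Require Import structures.
From mathcomp Require Import all_boot all_order all_algebra.
From mathcomp Require Import reals exp.
From mathcomp Require Import ring lra.

Set Implicit Arguments.
Unset Strict Implicit.
Unset Printing Implicit Defensive.

Import Order.TTheory GRing.Theory Num.Theory.
Local Open Scope ring_scope.

(** Three distinct coordinates are fixed and the others are free. The factor [#|W| ^ 3] avoids the
    truncated exponent [#|I| - 3]. *)
Lemma card_ffun_eq3 (I W : finType) (i j k : I) (x y z : W) :
  uniq [:: i; j; k] ->
  (#|W| ^ 3 * #|[set f : {ffun I -> W} | [&& f i == x, f j == y & f k == z]]|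
    = #|W| ^ #|I|)%N.
Proof.
rewrite /= !inE negb_or andbT => /andP[/andP[ij ik] jk].
pose F (l : I) : {pred W} :=
  if l == i then pred1 x else if l == j then pred1 y
  else if l == k then pred1 z else predT.
have Fi : F i = pred1 x by rewrite /F eqxx.
have Fj : F j = pred1 y by rewrite /F eq_sym (negPf ij) eqxx.
have Fk : F k = pred1 z
  by rewrite /F eq_sym (negPf ik) eq_sym (negPf jk) eqxx.
have FT l : l != i -> l != j -> l != k -> F l = predT.
  by rewrite /F => /negPf -> /negPf -> /negPf ->.
have -> : #|[set f : {ffun I -> W} | [&& f i == x, f j == y & f k == z]]|
    = #|family F|.
  apply: eq_card => f; rewrite inE; apply/idP/familyP.
    move=> /and3P[fi fj fk] l; rewrite /F.
    by case: eqP => [->//|_]; case: eqP => [->//|_]; case: eqP => [->|].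
  move=> H; move: (H i) (H j) (H k).
  by rewrite Fi Fj Fk !inE => -> -> ->.
rewrite -prod_nat_const card_family foldrE big_map big_enum /=.
rewrite (bigD1 i) // (bigD1 j) 1?eq_sym // (bigD1 k) /=; last first.
  by rewrite eq_sym ik eq_sym jk.
rewrite [in RHS](bigD1 i) // [in RHS](bigD1 j) 1?eq_sym // [in RHS](bigD1 k) /=.
  rewrite Fi Fj Fk !card1 !mul1n !expnS expn0 muln1 -!mulnA.
  do 3!congr (_ * _)%N.
  by apply: eq_bigr => l /andP[/andP[li lj] lk]; rewrite FT.
by rewrite eq_sym ik eq_sym jk.
Qed.

(** For uniformly random [f], the values at three distinct indices are independent and uniform; this
    is the resulting expectation with denominators cleared. *)
Lemma card_ffun_rel3 (I W : finType) (B : W -> W -> W -> bool) (i j k : I) :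
  uniq [:: i; j; k] ->
  (#|W| ^ 3 * (\sum_(f : {ffun I -> W}) B (f i) (f j) (f k))
    = (\sum_x \sum_y \sum_z B x y z) * #|W| ^ #|I|)%N.
Proof.
move=> ijk.
have E (f : {ffun I -> W}) : (B (f i) (f j) (f k) : nat) =
    (\sum_x \sum_y \sum_z B x y z * [&& f i == x, f j == y & f k == z])%N.
  rewrite (bigD1 (f i)) //= (bigD1 (f j)) //= (bigD1 (f k)) //= !eqxx muln1.
  rewrite !big1 ?addn0 // => x xi.
  - by apply: big1 => y _; apply: big1 => z _; rewrite eq_sym (negPf xi) muln0.
  - by apply: big1 => z _; rewrite andTb [f j == x]eq_sym (negPf xi) muln0.
  - by rewrite [f k == x]eq_sym (negPf xi) !andTb muln0.
rewrite (eq_bigr _ (fun f _ => E f)) exchange_big big_distrr big_distrl /=.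
apply: eq_bigr => x _; rewrite exchange_big big_distrr big_distrl /=.
apply: eq_bigr => y _; rewrite exchange_big big_distrr big_distrl /=.
apply: eq_bigr => z _; rewrite -big_distrr /= mulnCA; congr (_ * _)%N.
rewrite -(card_ffun_eq3 x y z ijk); congr (_ * _)%N.
by rewrite -sum1dep_card [RHS]big_mkcond; apply: eq_bigr => f _; case: ifP.
Qed.

(* Only indices are required distinct: the words f i may coincide, in which
   case a triple never triffers and is bad as soon as m > 0. *)
Definition bad_triples (I W : finType) (B : W -> W -> W -> bool) (f : I -> W) :
    {set I * I * I} :=
  [set t | uniq [:: t.1.1; t.1.2; t.2] && B (f t.1.1) (f t.1.2) (f t.2)].

(** First-moment argument: some [f] does no worse than the average number of bad triples, and there
    are at most [#|I| ^ 3] index triples. *)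
Lemma exists_few_bad_triples (I W : finType) (B : W -> W -> W -> bool) :
  (0 < #|W|)%N ->
  exists f : {ffun I -> W},
    (#|W| ^ 3 * #|bad_triples B f| <= #|I| ^ 3 * \sum_x \sum_y \sum_z B x y z)%N.
Proof.
move=> W0; set b := (\sum_x _)%N.
apply/existsP; apply: contraT; rewrite negb_exists => /forallP H.
suff : (\sum_(f : {ffun I -> W}) #|I| ^ 3 * b
        < \sum_(f : {ffun I -> W}) #|I| ^ 3 * b)%N by rewrite ltnn.
apply: (@leq_trans (\sum_(f : {ffun I -> W}) #|W| ^ 3 * #|bad_triples B f|)%N).
  (* Strictness of the summed inequality needs at least one term. *)
  have [f0 _] : exists f0 : {ffun I -> W}, true.
    by case/card_gt0P: W0 => w _; exists [ffun=> w].
  rewrite (bigD1 f0) //= [leqRHS](bigD1 f0) //= -addSn leq_add //.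
    by rewrite ltnNge H.
  by apply: leq_sum => f _; apply: ltnW; rewrite ltnNge H.
have E (f : {ffun I -> W}) : #|bad_triples B f| =
    (\sum_(t : I * I * I | uniq [:: t.1.1; t.1.2; t.2])
       B (f t.1.1) (f t.1.2) (f t.2))%N.
  rewrite -sum1dep_card [LHS]big_mkcondr.
  by apply: eq_bigr => t _; case: ifP.
rewrite -big_distrr (eq_bigr _ (fun f _ => E f)) exchange_big big_distrr /=.
rewrite (eq_bigr (fun=> b * #|W| ^ #|I|))%N; last first.
  by move=> t; apply: card_ffun_rel3.
rewrite !sum_nat_const card_ffun.
rewrite [leqRHS]mulnC -mulnA leq_mul2r; apply/orP; right.
by apply: (leq_trans (max_card _)); rewrite !card_prod !expnS expn0 muln1 mulnA.
Qed.

Lemma trifferE (n : nat) (x y z : word n) (i : 'I_n) :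
  triffer x y z i = uniq [:: x i; y i; z i].
Proof.
rewrite /triffer; move: (x i) (y i) (z i) => a b c.
by rewrite eqEcard subsetT cardsT card_ord -setUA !cardsU1 cards1 /= !inE;
  case: (a == b); case: (a == c); case: (b == c).
Qed.

(** The weight is a product over positions, so the sum factors; at each position 6 letter triples
    have weight [theta] and the other 21 have weight 1. *)
Lemma sum_exp_triffer (R : realType) (n : nat) (theta : R) :
  \sum_(x : word n) \sum_(y : word n) \sum_(z : word n)
    theta ^+ #|[set i | triffer x y z i]| = (21 + 6 * theta) ^+ n.
Proof.
pose g (a b c : 'I_3) := if uniq [:: a; b; c] then theta else 1.
have E (x y z : word n) : theta ^+ #|[set i | triffer x y z i]|
    = \prod_i g (x i) (y i) (z i).
  rewrite -sum1dep_card -prodrXr big_mkcond.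
  by apply: eq_bigr => i _; rewrite /g trifferE; case: ifP; rewrite ?expr1.
under eq_bigr => x _ do under eq_bigr => y _ do
  (under eq_bigr => z _ do rewrite E;
   rewrite -(bigA_distr_bigA (fun i c => g (x i) (y i) c))).
under eq_bigr => x _ do
  rewrite -(bigA_distr_bigA (fun i b => \sum_c g (x i) b c)).
rewrite -(bigA_distr_bigA (fun _ a => \sum_b \sum_c g a b c)).
rewrite prodr_const card_ord; congr (_ ^+ _).
by rewrite !big_ord_recl !big_ord0 /g /=; ring.
Qed.

Definition few_triffer (n m : nat) (x y z : word n) : bool :=
  (#|[set i | triffer x y z i]| < m)%N.

(** Chernoff-type bound: as [theta <= 1], a triple triffering in fewer than [m] positions has weight
    at least [theta ^+ m], and all other weights are nonnegative. *)
Lemma card_few_triffer (R : realType) (n m : nat) (theta : R) :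
  0 < theta -> theta <= 1 ->
  (\sum_(x : word n) \sum_(y : word n) \sum_(z : word n)
     few_triffer m x y z)%:R * theta ^+ m <= (21 + 6 * theta) ^+ n.
Proof.
move=> t0 t1; rewrite -sum_exp_triffer natr_sum mulr_suml.
apply: ler_sum => x _; rewrite natr_sum mulr_suml.
apply: ler_sum => y _; rewrite natr_sum mulr_suml.
apply: ler_sum => z _; rewrite /few_triffer.
case: ltnP => [lt_m|_]; rewrite ?mul1r ?mul0r ?exprn_ge0 ?(ltW t0) //.
by rewrite ler_wiXn2l ?(ltW t0) ?(ltnW lt_m).
Qed.

Lemma T_gt0 (n m : nat) : (0 < T n m)%N.
Proof.
pose w : word n := [ffun=> ord0].
rewrite -(cards1 w); apply: leq_bigmax_cond.
apply/forall_inP => x /set1P ->; apply/forall_inP => y /set1P ->.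
by apply/forall_inP => z _; rewrite eqxx.
Qed.

Lemma triffer_uniq (n : nat) (x y z : word n) (i : 'I_n) :
  triffer x y z i -> uniq [:: x; y; z].
Proof.
rewrite trifferE /= !inE !negb_or !andbT => /andP[/andP[xy xz] yz].
have neq (u v : word n) : u i != v i -> u != v by apply: contra_neq => ->.
by rewrite !neq.
Qed.

Lemma T_ge_deletion (I : finType) (n m : nat) (f : I -> word n) :
  (0 < m)%N -> (2 < #|I|)%N ->
  (#|I| <= T n m + #|bad_triples (few_triffer m) f|)%N.
Proof.
move=> m0 I3; set Bad := bad_triples _ f.
(* Deleting first entries suffices: every bad triple loses an index, at a cost of at most [#|Bad|]
   indices. *)
pose S := ~: [set t.1.1 | t in Bad].
have good i j k : i \in S -> uniq [:: i; j; k] ->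
    (m <= #|[set l | triffer (f i) (f j) (f k) l]|)%N.
  move=> iS ijk; rewrite leqNgt; apply: contraTN iS => few.
  by rewrite inE negbK; apply/imsetP; exists (i, j, k); rewrite // inE ijk.
(* If two surviving indices carried the same word, then with any third index, which exists by
   [2 < #|I|], they would form a triple triffering nowhere, against [0 < m]. *)
have injf : {in S &, injective f}.
  move=> i j iS jS fij; apply/eqP; apply: contraT => ij.
  have : (0 < #|~: [set i; j]|)%N.
    rewrite -(ltn_add2l #|[set i; j]|) cardsC addn0 (leq_ltn_trans _ I3) //.
    by rewrite cards2 ij.
  case/card_gt0P => k; rewrite !inE negb_or => /andP[ki kj].
  have /(good i j k iS) : uniq [:: i; j; k].
    by rewrite /= !inE negb_or ij eq_sym ki eq_sym kj.
  move=> /(leq_trans m0) /card_gt0P[l]; rewrite inE => /triffer_uniq.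
  by rewrite fij /= !inE eqxx.
have SI : (#|I| <= #|S| + #|Bad|)%N.
  rewrite -(cardsC S) leq_add2l setCK; exact: leq_imset_card.
apply: (leq_trans SI); rewrite leq_add2r -(card_in_imset injf).
apply: leq_bigmax_cond.
apply/forall_inP => _ /imsetP[i iS ->]; apply/forall_inP => _ /imsetP[j jS ->].
apply/forall_inP => _ /imsetP[k kS ->]; apply/implyP => /and3P[ij jk ik].
apply: good => //=; rewrite !inE negb_or.
have neq i' j' : f i' != f j' -> i' != j' by apply: contra_neq => ->.
by rewrite !neq.
Qed.

Lemma T_ge_expurgation (R : realType) (n m : nat) (A : R) :
  (0 < m)%N -> 0 < A ->
  A ^+ 2 * (\sum_(x : word n) \sum_(y : word n) \sum_(z : word n)
     few_triffer m x y z)%:R <= (27 ^ n)%:R ->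
  A / 6 <= (T n m)%:R.
Proof.
move=> m0 A0; set b := (\sum_x _)%N => Ab.
(* For [A <= 6] the bound is at most 1; otherwise [M] is at least 3, as the deletion step
   requires. *)
have [A6|A6] := leP A 6.
  have : 1 <= (T n m)%:R :> R by rewrite ler1n T_gt0.
  by lra.
pose M := Num.truncn (A / 2).
have /andP[M1 M2] : M%:R <= A / 2 < M.+1%:R by apply: truncn_itv; lra.
have M3 : (2 < M)%N by rewrite -ltnS -(ltr_nat R); lra.
have W0 : (0 < #|word n|)%N by rewrite card_ffun !card_ord expn_gt0.
have [f] := exists_few_bad_triples 'I_M (@few_triffer n m) W0.
have := T_ge_deletion f m0; rewrite card_ord => /(_ M3).
set d := #|bad_triples _ _|; rewrite -/b.
rewrite card_ffun !card_ord expnAC -(ler_nat R) => Md.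
rewrite -(ler_nat R) natrM [leRHS]natrM => db.
have A2 : 0 < A ^+ 2 by rewrite exprn_gt0.
have N0 : 0 < (27 ^ n)%:R :> R by rewrite ltr0n expn_gt0.
have Ad : A ^+ 2 * d%:R <= (M ^ 3)%:R.
  rewrite -(ler_pM2l N0) mulrCA (le_trans (ler_wpM2l (ltW A2) db)) //.
  by rewrite mulrCA [leRHS]mulrC ler_wpM2l.
(* From [M <= A / 2], the bound [M ^ 3 / A ^ 2] on [d] is at most [M / 4]. *)
have dM : d%:R <= M%:R / 4 :> R.
  rewrite -(ler_pM2l A2) (le_trans Ad) // natrX exprS.
  have : M%:R ^+ 2 <= A ^+ 2 / 4.
    have -> : A ^+ 2 / 4 = (A / 2) ^+ 2 by field.
    by rewrite lerXn2r // nnegrE //; lra.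
  have : 0 <= M%:R :> R by [].
  by move=> M0 H; rewrite [leRHS]mulrCA ler_wpM2l.
(* At least [3 / 4 * M > 3 / 4 * (A / 2 - 1)] words remain, which exceeds [A / 6] since [A > 6]. *)
move: Md M2; rewrite natrD -[in M.+1%:R]natr1; lra.
Qed.

Theorem theorem1p8 (R : realType) (lambda : R)
    (lambda_gt0 : 0 < lambda) (lambda_lt : lambda < 2 / 9) :
  exists (c : R) (n0 : nat), 0 < c /\
    forall n : nat, (n0 <= n)%N ->
      c * (9 / 2 * lambda) `^ (1 / 2 * lambda * n%:R)
        * (9 / 7 * (1 - lambda)) `^ (1 / 2 * (1 - lambda) * n%:R)
      <= (T n (Num.truncn (lambda * n%:R)))%:R.
Proof.
(* n0 > 1 / lambda ensures m > 0. *)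
exists (1 / 6), (Num.truncn lambda^-1).+1; split=> [|n n_ge]; first by lra.
set m := Num.truncn _.
set p := 9 / 2 * lambda; set q := 9 / 7 * (1 - lambda).
have p0 : 0 < p by rewrite /p; lra.
have q0 : 0 < q by rewrite /q; lra.
have ln1 : 1 < lambda * n%:R.
  rewrite mulrC -ltr_pdivrMr // mul1r.
  by apply: (lt_le_trans (truncnS_gt _)); rewrite ler_nat.
have /andP[mle _] : m%:R <= lambda * n%:R < m.+1%:R by apply: truncn_itv; lra.
have m0 : (0 < m)%N by rewrite truncn_gt0 ltW.
pose A := p `^ (1 / 2 * lambda * n%:R) * q `^ (1 / 2 * (1 - lambda) * n%:R).
have -> : 1 / 6 * p `^ (1 / 2 * lambda * n%:R)
    * q `^ (1 / 2 * (1 - lambda) * n%:R) = A / 6 by rewrite /A; field.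
have A0 : 0 < A by rewrite mulr_gt0 ?powR_gt0.
apply: T_ge_expurgation => //; set b := (\sum_x _)%N.
pose theta := p / q.
have t0 : 0 < theta by rewrite divr_gt0.
have t1 : theta <= 1 by rewrite ler_pdivrMr // mul1r /p /q; lra.
have tm : theta `^ (lambda * n%:R) <= theta ^+ m.
  by rewrite -powR_mulrn ?(ltW t0) // ger_powR // t0.
have t27 : 21 + 6 * theta = 27 / q by rewrite /theta /p /q; field; lra.
have A2 : A ^+ 2 * (27 / q) ^+ n = (27 ^ n)%:R * theta `^ (lambda * n%:R).
  rewrite /A exprMn -!(powR_mulrn _ (powR_ge0 _ _)) -!powRrM.
  have -> : 1 / 2 * lambda * n%:R * 2 = lambda * n%:R by field.
  have -> : 1 / 2 * (1 - lambda) * n%:R * 2 = n%:R - lambda * n%:R by field.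
  have -> : p = theta * q by rewrite /theta divfK ?gt_eqF.
  rewrite powRM ?(ltW t0) ?(ltW q0) //
    -[_ * _ * q `^ _]mulrA -powRD; last first.
    by rewrite (gt_eqF q0) implybT.
  rewrite addrC subrK powR_mulrn ?(ltW q0) // 
    -mulrA -exprMn mulrC natrX.
  by congr (_ ^+ _ * _); field; lra.
rewrite -(ler_pM2r (powR_gt0 (lambda * n%:R) t0)) -A2 -mulrA.
rewrite ler_wpM2l ?exprn_ge0 ?(ltW A0) // -t27.
apply: le_trans (card_few_triffer n m t0 t1).
by rewrite ler_wpM2l.
Qed.
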